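(* Suppose Assumption (N) holds. Let $(f^n)_n$ in $Y$ and $f^\dagger\in Y$ be such that $\delta_i^n:=\|f_i^\dagger-f_i^n\|_{Y_i}\to0$ as $n\to\infty$ for $i\in\{1,\dots,N\}$. For a given subset $I\subset\{1,\dots,N\}$ with $I^c=\{1,\dots,N\}\setminus I$, choose $\lambda^n=(\lambda_1^n,\dots,\lambda_N^n)\in(0,\infty)^N$ such that $$\lambda_i^n\to\infty\ \text{ as well as }\ \lambda_i^n(\delta_i^n)^{p_i}\to0\quad\text{for }i\in I,\qquad\lambda_i^n\to\lambda_i^\dagger\in(0,\infty)\quad\text{for }i\in I^c,$$ and denote $\lambda^\dagger=\lim_{n\to\infty}\lambda^n\in(0,\infty]^N$. If $\operatorname{dom}(R)\cap\bigcap_{i=1}^N\operatorname{dom}(T_i)\ne\emptyset$, then there exists a sequence $(u^n)_n$ of solutions to the problems $\min_{u\in\operatorname{dom}(T)}J_{\lambda^n}(u,f^n)$, and every such sequence of solutions possesses a $\tau_X$-convergent subsequence, again denoted by $(u^n)_n$, with limit $u^\dagger$ such that $$\|T_iu^n-f_i^n\|_{Y_i}=o((\lambda_i^n)^{-1/p_i})\quad\text{for }i\in I,$$ $$\lim_{n\to\infty}\|T_iu^n-f_i^n\|_{Y_i}=\|T_iu^\dagger-f_i^\dagger\|_{Y_i}\quad\text{for }i\in I^c,$$ $$\lim_{n\to\infty}R(u^n)=R(u^\dagger),$$ and every limit of a $\tau_X$-convergent subsequence of solutions is a solution to $$\min_{\substack{u\in\operatorname{dom}(T)\\ T_Iu=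f_I^\dagger}}J_{\lambda^\dagger}(u,f^\dagger).$$
   Context: Setting. Let $(X,\|\cdot\|_X)$ be a Banach space and $R\colon X\to[0,\infty]$, $\operatorname{dom}(R)=\{u:R(u)<\infty\}$. For $i=1,\dots,N$ let $(Y_i,\|\cdot\|_{Y_i})$ be a normed space, $p_i\in[1,\infty)$ and $T_i\colon\operatorname{dom}(T_i)\subset X\to Y_i$ an operator. Put $\operatorname{dom}(T)=\bigcap_{i=1}^N\operatorname{dom}(T_i)$ and $Y=Y_1\times\cdots\times Y_N$. For $u\in\operatorname{dom}(T)$, $f\in Y$ and $\lambda\in(0,\infty]^N$ let $$J_\lambda(u,f)=R(u)+\sum_{i=1}^N\lambda_i\|T_iu-f_i\|_{Y_i}^{p_i},$$ where for $\lambda_i=\infty$ the $i$-th term is $0$ if $T_iu=f_i$ and $\infty$ otherwise. For $I\subset\{1,\dots,N\}$, $T_Iu=f_I^\dagger$ means $T_iu=f_i^\dagger$ for all $i\in I$. Let $\tau_X$ be a Hausdorff topology on $X$ and, for each $i$, $\tau_{Y_i}$ a Hausdorff topology on $Y_i$. Assumption (N): (1) Each $\|\cdot\|_{Y_i}$ is sequentially lower semi-continuous w.r.t. $\tau_{Y_i}$, and addition and scalar multiplication are continuous in the topology $\tau_{Y_i}$. (2) $R$ is lower semi-continuous w.r.t. $\tau_X$. (3) Each $T_i$ is continuous from $(X,\tau_X)$ (on $\operatorname{dom}(T_i)$) to $(Y_i,\tau_{Y_i})$ and $\operatorname{dom}(T_i)$ is closed w.r.t. convergence in $\tau_X$. (4)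 For any $\lambda\in(0,\infty)^N$, $f\in Y$ and any sequence $(u^n)_n$: if $J_\lambda(u^n,f)<c$ for all $n$ and some constant $c$, then $(u^n)_n$ admits a $\tau_X$-convergent subsequence. Notation: $x^n=o(y^n)$ means $x^n/y^n\to0$.
   Formalization: The convergence claims (not existence of minimizers) are stated under the added assumption that some u in dom(R) ∩ dom(T) satisfies T_I u = f_I^†; without it they fail, e.g. R(u)=u², T_1=0, p_1=2, f^n=f^†=1, I={1}. *)

(* Defs.v *)
From HB Require Import structures.
From mathcomp Require Import all_boot all_order all_algebra.
From mathcomp Require Import all_classical all_reals all_analysis.

Set Implicit Arguments.
Unset Strict Implicit.
Unset Printing Implicit Defensive.

Import Order.TTheory GRing.Theory Num.Theory.
Import numFieldNormedType.Exports.

Local Open Scope classical_set_scope.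
Local Open Scope ring_scope.

(* The Banach space X and the normed spaces Y_i carry, besides their norm
   topology, an auxiliary topology [tau : Topological T] on the same carrier.
   In the next definitions T is a bare Type, so that [Topological.Pack tau] is
   the only topology that can be inferred on it. *)

Definition cvg_in (T : Type) (tau : Topological T) (u : nat -> T) (x : T) :
    Prop :=
  u @ \oo --> (x : Topological.Pack tau).

Definition seq_closed_in (T : Type) (tau : Topological T) (A : set T) : Prop :=
  forall (u : nat -> T) (x : T),
    (forall n, A (u n)) -> cvg_in tau u x -> A x.

Definition lsc_in (R : realType) (T : Type) (tau : Topological T)
    (F : T -> \bar R) : Prop :=
  lower_semicontinuous (F : Topological.Pack tau -> \bar R).

Definition seq_lsc_in (R : realType) (T : Type) (tau : Topological T)
    (F : T -> \bar R) : Prop :=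
  forall (u : nat -> T) (x : T),
    cvg_in tau u x -> (F x <= limn_einf (F \o u))%E.

Definition continuous_on_in (S T : Type) (tauS : Topological S)
    (tauT : Topological T) (A : set S) (g : S -> T) : Prop :=
  let S' : topologicalType := Topological.Pack tauS in
  let T' : topologicalType := Topological.Pack tauT in
  {within (A : set S'), continuous (g : S' -> T')}.

Definition add_continuous_in (T : Type) (tau : Topological T)
    (add : T -> T -> T) : Prop :=
  let T' : topologicalType := Topological.Pack tau in
  continuous ((fun z => add z.1 z.2) : T' * T' -> T').

Definition scale_continuous_in (R : realType) (T : Type) (tau : Topological T)
    (scale : R -> T -> T) : Prop :=
  let T' : topologicalType := Topological.Pack tau in
  continuous ((fun z => scale z.1 z.2) : R * T' -> T').

Definition strictly_increasing (phi : nat -> nat) : Prop :=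
  {homo phi : m n / (m < n)%N}.

Definition is_minimizer (R : realType) (T : Type) (A : set T) (F : T -> \bar R)
    (u : T) : Prop :=
  A u /\ forall v, A v -> (F u <= F v)%E.

Section Tikhonov.
Context {R : realType} {X : completeNormedModType R} {N : nat}
  {Y : 'I_N -> normedModType R}.

(* An operator T_i : dom(T_i) -> Y_i is a domain DT i together with a total
   function T i whose values outside DT i are irrelevant. *)
Variables (Reg : X -> \bar R) (p : 'I_N -> R) (DT : 'I_N -> set X)
  (T : forall i, X -> Y i).

Definition domR : set X := [set u | (Reg u < +oo)%E].

Definition domT : set X := \bigcap_i DT i.

Definition discrepancy (i : 'I_N) (l : \bar R) (u : X) (fi : Y i) : \bar R :=
  if l == +oo%E then (if T i u == fi then 0%E else +oo%E)
  else (l * (`|T i u - fi| `^ p i)%:E)%E.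

Definition J (lam : 'I_N -> \bar R) (u : X) (f : forall i, Y i) : \bar R :=
  (Reg u + \sum_(i < N) discrepancy (lam i) u (f i))%E.

Definition constrained (I : {set 'I_N}) (f : forall i, Y i) : set X :=
  [set u | domT u /\ forall i, i \in I -> T i u = f i].

(* The point required here cannot be dispensed with in convergence statements:
   for X = Y_1 = R (the reals), Reg u = u^2, T_1 = 0, p_1 = 2, I = {1},
   f^n = f = 1 and lambda^n -> +oo, no u satisfies T_1 u = f, and the minimizers
   u^n = 0 of u^2 + lambda^n |T_1 u - f^n|^2 have the constant residual 1. *)
Definition limit_feasible (I : {set 'I_N}) (f : forall i, Y i) : Prop :=
  domR `&` constrained I f !=set0.

Definition assumptionN (tauX : Topological X)
    (tauY : forall i, Topological (Y i)) : Prop :=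
  [/\ forall i, [/\ seq_lsc_in (tauY i) (fun y : Y i => (`|y|)%:E),
                    add_continuous_in (tauY i) (fun y z : Y i => y + z)
                  & scale_continuous_in (tauY i)
                      (fun (a : R) (y : Y i) => a *: y)],
      lsc_in tauX Reg,
      forall i, continuous_on_in tauX (tauY i) (DT i) (T i) /\
                seq_closed_in tauX (DT i)
    & forall (lam : 'I_N -> R) (f : forall i, Y i) (u : nat -> X) (c : R),
        (forall i, 0 < lam i) ->
        (forall n, domT (u n)) ->
        (forall n, (J (fun i => (lam i)%:E) (u n) f < c%:E)%E) ->
        exists (phi : nat -> nat) (x : X),
          strictly_increasing phi /\ cvg_in tauX (u \o phi) x].

End Tikhonov.

(* Main.v *)
Require Import Defs.
From HB Require Import structures.
From mathcomp Require Import all_boot all_order all_algebra.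
From mathcomp Require Import all_classical all_reals all_analysis.
From mathcomp Require Import lra.

Set Implicit Arguments.
Unset Strict Implicit.
Unset Printing Implicit Defensive.

Import Order.TTheory GRing.Theory Num.Theory.
Import numFieldNormedType.Exports.

Local Open Scope classical_set_scope.
Local Open Scope ring_scope.

(** Fix a feasible competitor w: R(w) is finite, w lies in every dom(T_i), and
    T_i w = fd_i for i in I.  Comparing u^n with w in the problem solved by u^n
    gives

      R(u^n) + sum_i lam_i^n |T_i u^n - f_i^n|^p_i
        <= R(w) + sum_i lam_i^n |T_i w - f_i^n|^p_i.

    On the right the terms with i in I equal lam_i^n (delta_i^n)^p_i and tend to
    0, so the right-hand side tends to J_lamd(w, fd).  Apart from existence,
    everything follows from this inequality.

    Compactness.  Its right-hand side is bounded and the weights lam_i^n stay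
    away from 0, hence the residuals are bounded.  So is the functional with all
    weights 1 and the fixed data fd along (u^n), and the compactness assumption
    applies to that single functional ([minimizers_compact]).

    Lower semicontinuity.  If v^n tends to x in tau_X, then T_i v^n - fd_i tends
    to T_i x - fd_i in tau_{Y_i}; the data f^n and fd are close in norm, and the
    norm is sequentially lower semicontinuous, so |T_i x - fd_i| is at most the
    lower limit of |T_i v^n - f_i^n| ([residual_liminf_ge]).  As all terms are
    nonnegative, this and the lower semicontinuity of R yield that of the whole
    functional along changing data and weights ([J_liminf]); it gives the
    existence of minimizers by the direct method ([exists_minimizer]).

    The limit.  Let u be a limit of (u^n).  For i in I, boundedness of
    lam_i^n |T_i u^n - f_i^n|^p_i with lam_i^n tending to infinity forces
    T_i u = fd_i ([limit_constrained]).  On points satisfying these constraints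
    J_lamd(-, fd) is the functional whose weights are 0 on I, and [J_liminf]
    applied to the displayed inequality shows that u is optimal
    ([limit_minimizer]).

    Convergence of each term.  Since u is itself feasible, take w = u.  Now the
    sum of the terms is bounded above by a sequence whose limit is the sum of the
    lower bounds of their lower limits, so no term can stay above its own bound:
    each one converges ([J_attained_cvg]).  For i in I this says that
    lam_i^n |T_i u^n - f_i^n|^p_i tends to 0, the stated rate after taking p_i-th
    roots; for i outside I it gives the convergence of the residuals, and it
    gives the convergence of R(u^n). *)

(** * Lower bounds on lower limits of real sequences *)

(** This is l <= liminf a, in a form that stays within the real numbers and that
    lower semicontinuity produces directly. *)
Definition liminf_ge (R : realType) (a : nat -> R) (l : R) : Prop :=
  forall r, r < l -> \forall n \near \oo, r < a n.

Section Asymptotics.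
Context {R : realType}.
Implicit Types (a b c : nat -> R) (l m : R).

Lemma liminf_ge_minorant a b l :
  b n @[n --> \oo] --> l -> (\forall n \near \oo, b n <= a n) -> liminf_ge a l.
Proof.
move=> bl ba r rl; near=> n; apply: (@lt_le_trans _ _ (b n)).
  by near: n; exact: cvgr_gt bl _ rl.
by near: n.
Unshelve. all: by end_near. Qed.

Lemma cvg_liminf_ge a l : a n @[n --> \oo] --> l -> liminf_ge a l.
Proof. by move=> /liminf_ge_minorant; apply; apply: nearW. Qed.

Lemma liminf_ge0 a : (forall n, 0 <= a n) -> liminf_ge a 0.
Proof. by move=> a0 r r0; apply: nearW => n; exact: lt_le_trans (a0 n). Qed.

(** Truncating a at l turns the one-sided bound into a genuine limit, so the
    closure properties below reduce to the usual calculus of limits applied to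
    the truncated sequences. *)
Lemma liminf_ge_cvg_min a l :
  liminf_ge a l -> Num.min (a n) l @[n --> \oo] --> l.
Proof.
move=> al; apply/cvgrPdist_lt => e e0; near=> n.
have lean : l - e < a n by near: n; apply: al; rewrite ltrBlDr ltrDl.
case: (leP (a n) l) => [anl|_]; last by rewrite subrr normr0.
by rewrite ger0_norm ?subr_ge0// ltrBlDr addrC -ltrBlDr.
Unshelve. all: by end_near. Qed.

Lemma liminf_ge_le a b l m :
  liminf_ge a l -> (\forall n \near \oo, a n <= b n) ->
  b n @[n --> \oo] --> m -> l <= m.
Proof.
move=> al ab bm; apply: ler_cvg_to (liminf_ge_cvg_min al) bm _.
near=> n; apply: (@le_trans _ _ (a n)); last by near: n.
by rewrite ge_min lexx.
Unshelve. all: by end_near. Qed.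

Lemma liminf_geD a b l m :
  liminf_ge a l -> liminf_ge b m -> liminf_ge (fun n => a n + b n) (l + m).
Proof.
move=> al bm; apply: liminf_ge_minorant.
  exact: cvgD (liminf_ge_cvg_min al) (liminf_ge_cvg_min bm).
by apply: nearW => n /=; rewrite lerD// ge_min lexx.
Qed.

Lemma liminf_ge_sum (K : Type) (s : seq K) (P : pred K) (a : K -> nat -> R)
    (l : K -> R) :
  (forall k, liminf_ge (a k) (l k)) ->
  liminf_ge (fun n => \sum_(k <- s | P k) a k n) (\sum_(k <- s | P k) l k).
Proof.
move=> al; apply: liminf_ge_minorant.
  by apply: (cvg_big (op := +%R)) => [|k _]; [exact: add_continuous
    | exact: (liminf_ge_cvg_min (al k))].
by apply: nearW => n /=; apply: ler_sum => k _; rewrite ge_min lexx.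
Qed.

Lemma liminf_geM a b l m :
  (forall n, 0 <= a n) -> (forall n, 0 <= b n) -> 0 <= l -> 0 <= m ->
  liminf_ge a l -> liminf_ge b m -> liminf_ge (fun n => a n * b n) (l * m).
Proof.
move=> a0 b0 l0 m0 al bm; apply: liminf_ge_minorant.
  exact: cvgM (liminf_ge_cvg_min al) (liminf_ge_cvg_min bm).
by apply: nearW => n /=; rewrite ler_pM ?le_min ?a0 ?b0 ?ge_min ?lexx.
Qed.

(** Differentiability of the power gives this only away from 0; at l = 0 it
    rests on monotonicity. *)
Lemma cvg_powR a l (p : R) :
  0 < p -> (forall n, 0 <= a n) -> a n @[n --> \oo] --> l ->
  a n `^ p @[n --> \oo] --> l `^ p.
Proof.
move=> p0 a0 al.
have : 0 <= l by apply: (cvgr_to_ge al); exact: nearW.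
rewrite le_eqVlt => /predU1P[l0|l0].
  rewrite -l0 in al *; rewrite powR0 ?gt_eqF//.
  apply/cvgr0Pnorm_lt => e e0; near=> n.
  rewrite ger0_norm ?powR_ge0//.
  have -> : e = (e `^ p^-1) `^ p.
    by rewrite -powRrM mulVf ?gt_eqF// powRr1// ltW.
  rewrite gt0_ltr_powR ?nnegrE ?powR_ge0//.
  by near: n; apply: cvgr_lt al _ _; rewrite powR_gt0.
apply: (@cvg_comp _ _ _ a (fun x => x `^ p) _ (nbhs l)) => //.
suff : {for l, continuous (fun x : R => x `^ p)} by [].
apply: differentiable_continuous; apply/derivable1_diffP.
by apply: ex_derive; exact: is_derive1_powR.
Unshelve. all: by end_near. Qed.

Lemma powR_invK (p y : R) : 0 < p -> 0 <= y -> (y `^ p) `^ p^-1 = y.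
Proof. by move=> p0 y0; rewrite -powRrM mulfV ?gt_eqF// powRr1. Qed.

Lemma liminf_ge_powR a l (p : R) :
  0 < p -> 0 <= l -> (forall n, 0 <= a n) ->
  liminf_ge a l -> liminf_ge (fun n => a n `^ p) (l `^ p).
Proof.
move=> p0 l0 a0 al; apply: liminf_ge_minorant.
  apply: cvg_powR p0 _ (liminf_ge_cvg_min al) => n.
  by rewrite le_min a0.
apply: nearW => n /=; apply: ge0_ler_powR; rewrite ?nnegrE ?le_min ?a0//.
- exact: ltW.
- by rewrite ge_min lexx.
Qed.

(** If the lower bounds l and m add up to the limit of an upper bound c of a + b,
    there is no slack: a is squeezed between its truncation at l and c minus the
    truncation of b at m. *)
Lemma liminf_ge_squeeze a b c l m :
  liminf_ge a l -> liminf_ge b m ->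
  (\forall n \near \oo, a n + b n <= c n) ->
  c n @[n --> \oo] --> l + m -> a n @[n --> \oo] --> l.
Proof.
move=> al bm abc clm.
apply: (squeeze_cvgr _ (liminf_ge_cvg_min al)
  (h := fun n => c n - Num.min (b n) m)).
  near=> n; apply/andP; split; first by rewrite ge_min lexx.
  have : a n + b n <= c n by near: n.
  have : Num.min (b n) m <= b n by rewrite ge_min lexx.
  by lra.
rewrite -[X in _ --> X](addrK m); exact: cvgB clm (liminf_ge_cvg_min bm).
Unshelve. all: by end_near. Qed.

End Asymptotics.

Lemma strictly_increasing_cvg (phi : nat -> nat) :
  strictly_increasing phi -> phi n @[n --> \oo] --> \oo.
Proof.
move=> phiS; have le_phi n : (n <= phi n)%N.
  elim: n => // n IH; apply: leq_ltn_trans IH _; exact: phiS.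
move=> A [M _ MA]; exists M => // n /= Mn; apply: MA => /=.
exact: leq_trans Mn (le_phi n).
Qed.

Lemma cvg_subseq (V : Type) (F : set_system V) (a : nat -> V)
    (phi : nat -> nat) :
  strictly_increasing phi -> a n @[n --> \oo] `=>` F ->
  a (phi n) @[n --> \oo] `=>` F.
Proof. by move=> /strictly_increasing_cvg phioo aF; exact: cvg_comp phioo aF. Qed.

(** * Lower semicontinuity for the auxiliary topologies *)

Section AuxiliaryTopologies.
Context {R : realType}.

Lemma lsc_in_eventually_gt (T : Type) (tau : Topological T) (F : T -> \bar R)
    (u : nat -> T) (x : T) (r : R) :
  lsc_in tau F -> cvg_in tau u x -> (r%:E < F x)%E ->
  \forall n \near \oo, (r%:E < F (u n))%E.
Proof.
move=> lscF ux /lscF[V Vx VF].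
have : \forall n \near \oo, V (u n) := ux _ Vx.
by apply: filterS => n /VF.
Qed.

Lemma seq_lsc_in_liminf_ge (T : Type) (tau : Topological T) (F : T -> R)
    (u : nat -> T) (x : T) :
  seq_lsc_in tau (EFin \o F) -> cvg_in tau u x -> liminf_ge (F \o u) (F x).
Proof.
move=> lscF ux r rFx; have := lscF _ _ ux.
rewrite limn_einf_lim (_ : limn _ = ereal_sup (range (einfs ((EFin \o F) \o u))));
  last by apply/cvg_lim => //; exact: cvg_einfs_sup.
move=> /(lt_le_trans (y := (F x)%:E) (x := r%:E)); rewrite lte_fin => /(_ rFx).
move=> /ereal_sup_gt[_ [n _ <-]] rn; exists n => // k /= nk.
rewrite -lte_fin; apply: (lt_le_trans rn); apply: ereal_inf_lbound.
by exists k.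
Qed.

Lemma continuous_on_in_cvg (S T : Type) (tauS : Topological S)
    (tauT : Topological T) (A : set S) (g : S -> T) (u : nat -> S) (x : S) :
  continuous_on_in tauS tauT A g -> (forall n, A (u n)) -> A x ->
  cvg_in tauS u x -> cvg_in tauT (g \o u) (g x).
Proof.
move=> /subspace_continuousP gc Au Ax ux B gB.
have : \forall n \near \oo, A (u n) -> B (g (u n)) := ux _ (gc x Ax B gB).
by apply: filterS => n; apply; exact: Au.
Qed.

Lemma add_continuous_in_cvg (T : Type) (tau : Topological T)
    (add : T -> T -> T) (u : nat -> T) (x y : T) :
  add_continuous_in tau add -> cvg_in tau u x ->
  cvg_in tau (fun n => add (u n) y) (add x y).
Proof.
move=> addc ux; rewrite /cvg_in.
apply: (@cvg_comp _ _ _ (fun n => (u n, y)) (fun z => add z.1 z.2) _ _ _ _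
  (addc (x, y))).
have yy : (fun=> y) n @[n --> \oo] --> (y : Topological.Pack tau).
  exact: (@cvg_cst (Topological.Pack tau)).
exact: cvg_pair ux yy.
Qed.

(** The auxiliary topology controls S (v n) - gd, the norm controls gd - g n, and
    the triangle inequality combines the two. *)
Lemma residual_liminf_ge (X : Type) (Y : normedModType R)
    (tauX : Topological X) (tauY : Topological Y) (D : set X) (S : X -> Y)
    (v : nat -> X) (x : X) (g : nat -> Y) (gd : Y) :
  seq_lsc_in tauY (fun y : Y => (`|y|)%:E) ->
  add_continuous_in tauY (fun y z : Y => y + z) ->
  continuous_on_in tauX tauY D S ->
  (forall n, D (v n)) -> D x -> cvg_in tauX v x ->
  `|gd - g n| @[n --> \oo] --> (0 : R) ->
  liminf_ge (fun n => `|S (v n) - g n|) `|S x - gd|.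
Proof.
move=> lscY addY Sc Dv Dx vx gnd.
have Svx := continuous_on_in_cvg Sc Dv Dx vx.
have := seq_lsc_in_liminf_ge (F := fun y : Y => `|y|) lscY
  (add_continuous_in_cvg (y := - gd) addY Svx).
(* The minorant is min (`|S (v n) - gd|, `|S x - gd|) - `|gd - g n|. *)
move=> /liminf_ge_cvg_min h; apply: liminf_ge_minorant.
  by rewrite -[X in _ --> X]subr0; exact: cvgB h gnd.
apply: nearW => n /=; rewrite lerBlDr.
apply: (@le_trans _ _ `|S (v n) - gd|); first by rewrite ge_min lexx.
rewrite (_ : S (v n) - gd = (S (v n) - g n) - (gd - g n)) ?ler_normB//.
by rewrite opprB addrA subrK.
Qed.

End AuxiliaryTopologies.

(** * The Tikhonov functional with finite weights *)

Definition penalty (R : realType) (X : completeNormedModType R) (N : nat)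
    (Y : 'I_N -> normedModType R) (p : 'I_N -> R) (T : forall i, X -> Y i)
    (l : 'I_N -> R) (v : X) (g : forall i, Y i) : R :=
  \sum_(i < N) l i * `|T i v - g i| `^ p i.

Section Functional.
Context {R : realType} {X : completeNormedModType R} {N : nat}
  {Y : 'I_N -> normedModType R} (Reg : X -> \bar R) (p : 'I_N -> R)
  (DT : 'I_N -> set X) (T : forall i, X -> Y i)
  (tauX : Topological X) (tauY : forall i, Topological (Y i))
  (Reg_ge0 : forall u, (0 <= Reg u)%E) (p_ge1 : forall i, 1 <= p i)
  (hN : assumptionN Reg p DT T tauX tauY).
Implicit Types (l m : 'I_N -> R) (v x : X) (g : forall i, Y i).

Lemma exponent_gt0 i : 0 < p i.
Proof. exact: lt_le_trans ltr01 (p_ge1 i). Qed.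

Lemma J_EFin l v g :
  J Reg p T (fun i => (l i)%:E) v g = (Reg v + (penalty p T l v g)%:E)%E.
Proof. by rewrite /J /penalty -sumEFin. Qed.

Lemma penalty_ge0 l v g : (forall i, 0 <= l i) -> 0 <= penalty p T l v g.
Proof. by move=> l0; apply: sumr_ge0 => i _; rewrite mulr_ge0// powR_ge0. Qed.

Lemma le_penalty l v g i : (forall j, 0 <= l j) ->
  l i * `|T i v - g i| `^ p i <= penalty p T l v g.
Proof.
move=> l0; rewrite /penalty (bigD1 i)//= lerDl.
by apply: sumr_ge0 => j _; rewrite mulr_ge0// powR_ge0.
Qed.

Lemma Reg_fin_num v (c : R) : (Reg v <= c%:E)%E -> Reg v \is a fin_num.
Proof. by move=> Rc; rewrite ge0_fin_numE//; exact: le_lt_trans Rc (ltry c). Qed.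

Lemma domT_limit (v : nat -> X) x :
  (forall n, domT DT (v n)) -> cvg_in tauX v x -> domT DT x.
Proof.
have [_ _ hT _] := hN => Dv vx i _.
by apply: (hT i).2 vx => n; exact: Dv.
Qed.

(** Both data and weights vary with n, and a limit weight m i only has to be a
    lower bound of the lower limit of the weights.  Hence m i = 0 is a legitimate
    choice for weights tending to infinity. *)
Section Limit.
Context (v : nat -> X) (x : X) (g : nat -> forall i, Y i) (gd : forall i, Y i)
  (l : nat -> 'I_N -> R) (m : 'I_N -> R)
  (Dv : forall n, domT DT (v n)) (vx : cvg_in tauX v x)
  (gnd : forall i, `|gd i - g n i| @[n --> \oo] --> (0 : R)).

Lemma residual_powR_liminf_ge i :
  liminf_ge (fun n => `|T i (v n) - g n i| `^ p i) (`|T i x - gd i| `^ p i).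
Proof.
have [hY _ hT _] := hN; have [lscY addY _] := hY i; have [Tc _] := hT i.
apply: liminf_ge_powR => //; first exact: exponent_gt0.
apply: (residual_liminf_ge lscY addY Tc _ _ vx (gnd i)) => [n|].
- exact: Dv.
- exact: domT_limit Dv vx _ _.
Qed.

Context (l_ge0 : forall n i, 0 <= l n i) (m_ge0 : forall i, 0 <= m i)
  (lm : forall i, liminf_ge (l^~ i) (m i))
  (U : nat -> R) (u : R) (Uu : U n @[n --> \oo] --> u)
  (leU : \forall n \near \oo,
     (Reg (v n) + (penalty p T (l n) (v n) (g n))%:E <= (U n)%:E)%E).

Let term i n := l n i * `|T i (v n) - g n i| `^ p i.
Let reg n := fine (Reg (v n)).

Let term_liminf i : liminf_ge (term i) (m i * `|T i x - gd i| `^ p i).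
Proof.
apply: liminf_geM => //.
exact: residual_powR_liminf_ge.
Qed.

Let near_fin : \forall n \near \oo, Reg (v n) = (reg n)%:E.
Proof.
apply: filterS leU => n Un; rewrite /reg fineK//; apply: (@Reg_fin_num _ (U n)).
by apply: le_trans Un; rewrite leeDl// lee_fin penalty_ge0.
Qed.

Let near_le : \forall n \near \oo, reg n + \sum_(i < N) term i n <= U n.
Proof.
near=> n; have Rn : Reg (v n) = (reg n)%:E by near: n.
have : (Reg (v n) + (penalty p T (l n) (v n) (g n))%:E <= (U n)%:E)%E.
  by near: n.
by rewrite Rn -EFinD lee_fin.
Unshelve. all: by end_near. Qed.

Let sum_ge0 n : 0 <= \sum_(i < N) term i n.
Proof. exact: penalty_ge0. Qed.

(** Reg (v n) is eventually at most u + 1, while an infinite Reg x would push it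
    above every real number. *)
Let Reg_lim_fin : Reg x \is a fin_num.
Proof.
have [_ lscR _ _] := hN.
rewrite ge0_fin_numE// ltNge; apply/negP => Roo.
have : \forall n \near \oo, ((u + 1)%:E < Reg (v n))%E.
  apply: lsc_in_eventually_gt lscR vx _.
  exact: lt_le_trans (ltry _) Roo.
have : \forall n \near \oo, U n < u + 1 by apply: cvgr_lt Uu _ _; rewrite ltrDl.
move=> Ult Rgt; have : \forall n \near \oo, False.
  near=> n; have Rn : Reg (v n) = (reg n)%:E by near: n.
  have : ((u + 1)%:E < Reg (v n))%E by near: n.
  rewrite Rn lte_fin.
  have : U n < u + 1 by near: n.
  have : reg n + \sum_(i < N) term i n <= U n by near: n.
  have := sum_ge0 n; lra.
by move=> [k _ /(_ k (leqnn k))].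
Unshelve. all: by end_near. Qed.

Let reg_liminf : liminf_ge reg (fine (Reg x)).
Proof.
have [_ lscR _ _] := hN => r rx.
have : \forall n \near \oo, (r%:E < Reg (v n))%E.
  by apply: lsc_in_eventually_gt lscR vx _; rewrite -[Reg x]fineK ?lte_fin.
by apply: filterS2 near_fin => n ->; rewrite lte_fin.
Qed.

(** Lower limits are superadditive and each summand is lower semicontinuous. *)
Lemma J_liminf : (Reg x + (penalty p T m x gd)%:E <= u%:E)%E.
Proof.
rewrite -[Reg x]fineK// -EFinD lee_fin.
apply: liminf_ge_le near_le Uu; apply: liminf_geD => //.
exact: liminf_ge_sum.
Qed.

(** Equality in [J_liminf] leaves no slack in any summand: split off one summand
    and apply [liminf_ge_squeeze] to it and the sum of all the others. *)
Lemma J_attained_cvg : u%:E = (Reg x + (penalty p T m x gd)%:E)%E ->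
  Reg (v n) @[n --> \oo] --> Reg x /\
  forall i, l n i * `|T i (v n) - g n i| `^ p i @[n --> \oo] -->
            m i * `|T i x - gd i| `^ p i.
Proof.
rewrite -{1}[Reg x]fineK// -EFinD => -[uE]; split => [|i].
  rewrite -[Reg x]fineK//; apply: cvg_EFin.
    by apply: filterS near_fin => n ->.
  apply: (liminf_ge_squeeze reg_liminf _ near_le).
    exact: liminf_ge_sum term_liminf.
  by rewrite -uE.
pose rest n := reg n + \sum_(j < N | j != i) term j n.
have rest_liminf : liminf_ge rest
    (fine (Reg x) + \sum_(j < N | j != i) m j * `|T j x - gd j| `^ p j).
  by apply: liminf_geD reg_liminf _; exact: liminf_ge_sum.
apply: (liminf_ge_squeeze (@term_liminf i) rest_liminf (c := U)).
- by apply: filterS near_le => n; rewrite (bigD1 i)//= /rest addrCA.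
- by move: Uu; rewrite uE /penalty (bigD1 i)//= addrCA.
Qed.

End Limit.

(** The direct method: along a minimizing sequence the functional is bounded,
    so a subsequence converges, and [J_liminf] with constant data and weights
    shows that its limit attains the infimum. *)
Lemma exists_minimizer l g :
  domR Reg `&` domT DT !=set0 -> (forall i, 0 < l i) ->
  exists x, is_minimizer (domT DT)
    (fun v => J Reg p T (fun i => (l i)%:E) v g) x.
Proof.
move=> [u0 [Ru0 Du0]] l0; have l_ge0 i : 0 <= l i by exact: ltW.
pose Jl v := J Reg p T (fun i => (l i)%:E) v g.
have J_ge0 v : (0 <= Jl v)%E by rewrite /Jl J_EFin adde_ge0// lee_fin penalty_ge0.
pose inf := ereal_inf (Jl @` domT DT).
have inf_le v : domT DT v -> (inf <= Jl v)%E.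
  by move=> Dv; apply: ereal_inf_lbound; exists v.
have inf_fin : inf \is a fin_num.
  rewrite ge0_fin_numE; last by apply: le_ereal_inf_tmp => _ [v _ <-].
  by apply: le_lt_trans (inf_le _ Du0) _; rewrite /Jl J_EFin lte_add_pinfty ?ltry.
have /choice[v vP] n : exists v, domT DT v /\ (Jl v < inf + n.+1%:R^-1%:E)%E.
  have n0 : 0 < n.+1%:R^-1 :> R by rewrite invr_gt0.
  by have [_ [w Dw <-] Jw] := lb_ereal_inf_adherent n0 inf_fin; exists w.
have Jv_lt n : (Jl (v n) < (fine inf + 2)%:E)%E.
  apply: lt_le_trans (vP n).2 _; rewrite EFinD fineK// leeD2l// lee_fin.
  by rewrite (@le_trans _ _ 1) ?ler1n// invf_le1 ?ler1n.
have [_ _ _ comp] := hN.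
have [phi [x [phiS vx]]] := comp l g v _ l0 (fun n => (vP n).1) Jv_lt.
have Dx : domT DT x.
  by apply: (domT_limit _ vx) => n; exact: (vP (phi n)).1.
exists x; split => // w Dw; apply: le_trans (inf_le _ Dw).
rewrite J_EFin -[inf]fineK//.
have g_cst i : `|g i - g i| @[n --> \oo] --> (0 : R).
  by rewrite subrr normr0; exact: cvg_cst.
have l_cst i : liminf_ge (fun=> l i) (l i).
  by apply: cvg_liminf_ge; exact: cvg_cst.
have U_cvg : fine inf + (phi n).+1%:R^-1 @[n --> \oo] --> fine inf.
  rewrite -[X in _ --> X]addr0; apply: cvgD; first exact: cvg_cst.
  apply: (@cvg_comp _ _ _ phi (fun n => n.+1%:R^-1) _ \oo).
    exact: strictly_increasing_cvg.
  exact: cvg_harmonic.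
apply: (J_liminf _ vx g_cst _ l_ge0 l_cst U_cvg) => //.
- by move=> n; exact: (vP (phi n)).1.
- apply: nearW => n; rewrite -J_EFin EFinD fineK//.
  exact: ltW (vP (phi n)).2.
Qed.

End Functional.

(** * Minimizers for vanishing noise *)

Definition parameter_choice (R : realType) (N : nat)
    (Y : 'I_N -> normedModType R) (p : 'I_N -> R) (I : {set 'I_N})
    (fd : forall i, Y i) (lamd : 'I_N -> \bar R)
    (f : nat -> forall i, Y i) (lam : nat -> 'I_N -> R) : Prop :=
  [/\ forall n i, 0 < lam n i,
      forall i, `|fd i - f n i| @[n --> \oo] --> (0 : R),
      forall i, i \in I -> lam n i @[n --> \oo] --> +oo /\
        lam n i * `|fd i - f n i| `^ p i @[n --> \oo] --> (0 : R),
      forall i, i \notin I -> (0 < lamd i < +oo)%E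
    & forall i, (lam n i)%:E @[n --> \oo] --> lamd i].

Lemma parameter_choice_subseq (R : realType) (N : nat)
    (Y : 'I_N -> normedModType R) (p : 'I_N -> R) (I : {set 'I_N})
    (fd : forall i, Y i) (lamd : 'I_N -> \bar R)
    (f : nat -> forall i, Y i) (lam : nat -> 'I_N -> R) (phi : nat -> nat) :
  strictly_increasing phi -> parameter_choice p I fd lamd f lam ->
  parameter_choice p I fd lamd (fun n => f (phi n)) (fun n => lam (phi n)).
Proof.
move=> phiS [lam0 hf hI hIc hlam]; split=> //.
- by move=> i; exact: (cvg_subseq phiS (hf i)).
- move=> i /hI[lamoo ldp]; split; first exact: (cvg_subseq phiS lamoo).
  exact: (cvg_subseq phiS ldp).
- by move=> i; exact: (cvg_subseq phiS (hlam i)).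
Qed.

Section Convergence.
Context {R : realType} {X : completeNormedModType R} {N : nat}
  {Y : 'I_N -> normedModType R} (Reg : X -> \bar R) (p : 'I_N -> R)
  (DT : 'I_N -> set X) (T : forall i, X -> Y i)
  (tauX : Topological X) (tauY : forall i, Topological (Y i))
  (Reg_ge0 : forall u, (0 <= Reg u)%E) (p_ge1 : forall i, 1 <= p i)
  (hN : assumptionN Reg p DT T tauX tauY).
Context (I : {set 'I_N}) (fd : forall i, Y i) (lamd : 'I_N -> \bar R)
  (f : nat -> forall i, Y i) (lam : nat -> 'I_N -> R)
  (hpar : parameter_choice p I fd lamd f lam).

Let lam_ge0 n i : 0 <= lam n i.
Proof. by have [lam0 _ _ _ _] := hpar; exact: ltW. Qed.

(** The weight 0 on I encodes the constraint: on feasible points the terms with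
    infinite weight vanish, and the functional with these real weights agrees
    with the one with weights lamd; see [J_constrained]. *)
Definition limit_weight (i : 'I_N) : R := if i \in I then 0 else fine (lamd i).

Lemma limit_weight_ge0 i : 0 <= limit_weight i.
Proof.
rewrite /limit_weight; case: ifPn => // iI.
have [_ _ _ /(_ i iI)/andP[l0 _] _] := hpar.
by apply: fine_ge0; exact: ltW.
Qed.

Lemma lamd_infty i : i \in I -> lamd i = +oo%E.
Proof.
move=> iI; have [_ _ /(_ i iI)[/cvgeryP lamoo _] _ /(_ i) laml] := hpar.
exact: (cvg_unique (@ereal_hausdorff R) laml lamoo).
Qed.

Lemma lamd_EFin i : i \notin I -> lamd i = (limit_weight i)%:E.
Proof.
move=> iI; have [_ _ _ /(_ i iI)/andP[l0 loo] _] := hpar.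
by rewrite /limit_weight (negbTE iI) fineK// ge0_fin_numE// ltW.
Qed.

Lemma limit_weight_gt0 i : i \notin I -> 0 < limit_weight i.
Proof.
move=> iI; have [_ _ _ /(_ i iI)/andP[+ _] _] := hpar.
by rewrite lamd_EFin// lte_fin.
Qed.

Lemma lam_cvg i : i \notin I -> lam n i @[n --> \oo] --> limit_weight i.
Proof.
move=> iI; have [_ _ _ _ /(_ i)] := hpar; rewrite lamd_EFin//.
by move=> /fine_cvgP[].
Qed.

Lemma lam_liminf_ge i : liminf_ge (lam^~ i) (limit_weight i).
Proof.
have [iI|iI] := boolP (i \in I); last exact: cvg_liminf_ge (lam_cvg iI).
by rewrite /limit_weight iI; exact: liminf_ge0.
Qed.

Lemma J_constrained (v : X) : constrained DT T I fd v ->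
  J Reg p T lamd v fd = (Reg v + (penalty p T limit_weight v fd)%:E)%E.
Proof.
move=> [_ Tv]; rewrite /J /penalty -sumEFin; congr (_ + _)%E.
apply: eq_bigr => i _; rewrite /discrepancy.
have [iI|iI] := boolP (i \in I); last by rewrite lamd_EFin.
by rewrite lamd_infty//= Tv// !eqxx /limit_weight iI mul0r.
Qed.

(** On a feasible point the i-th term with i in I is the noise term
    lam_i^n (delta_i^n)^p_i, which tends to 0. *)
Lemma penalty_cvg (v : X) : constrained DT T I fd v ->
  penalty p T (lam n) v (f n) @[n --> \oo] --> penalty p T limit_weight v fd.
Proof.
move=> [_ Tv]; apply: (cvg_big (op := +%R)) => [|i _].
  exact: add_continuous.
have [_ hf /(_ i) hI _ _] := hpar.
have [iI|iI] := boolP (i \in I).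
  by rewrite /limit_weight iI mul0r Tv//; have [] := hI iI.
apply: cvgM; first exact: lam_cvg.
apply: cvg_powR; [exact: exponent_gt0| by []|].
apply: cvg_norm; apply: cvgB; first exact: cvg_cst.
apply/cvgrPdist_lt => e e0; have /cvgr0Pnorm_lt/(_ e e0) := hf i.
by apply: filterS => n; rewrite normr_id.
Qed.

Section Minimizers.
Context (u : nat -> X) (hu : forall n, is_minimizer (domT DT)
  (fun v => J Reg p T (fun i => (lam n i)%:E) v (f n)) (u n)).

Lemma minimizer_le (v : X) (n : nat) : domT DT v ->
  (Reg (u n) + (penalty p T (lam n) (u n) (f n))%:E <=
   Reg v + (penalty p T (lam n) v (f n))%:E)%E.
Proof. by rewrite -!J_EFin; exact: (hu n).2. Qed.

Section Feasible.
Context (w : X) (Rw : domR Reg w) (Cw : constrained DT T I fd w).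

Let Rw_fin : Reg w \is a fin_num. Proof. by rewrite ge0_fin_numE. Qed.

Let U n := fine (Reg w) + penalty p T (lam n) w (f n).
Let bound := fine (Reg w) + penalty p T limit_weight w fd.

Let U_cvg : U n @[n --> \oo] --> bound.
Proof. by apply: cvgD; [exact: cvg_cst | exact: penalty_cvg]. Qed.

Let le_U n : (Reg (u n) + (penalty p T (lam n) (u n) (f n))%:E <= (U n)%:E)%E.
Proof.
by rewrite /U EFinD fineK//; apply: minimizer_le; have [] := Cw.
Qed.

Let U_le : \forall n \near \oo, U n <= bound + 1.
Proof. by apply: cvgr_le U_cvg _ _; rewrite ltrDl. Qed.

Lemma discrepancy_bounded i : exists2 C : R, 0 <= C & \forall n \near \oo,
  lam n i * `|T i (u n) - f n i| `^ p i <= C.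
Proof.
exists (bound + 1).
  by rewrite !addr_ge0 ?fine_ge0// penalty_ge0// => j; exact: limit_weight_ge0.
apply: filterS U_le => n; apply: le_trans.
apply: le_trans (le_penalty _ _ _ _ _ (lam_ge0 n)) _; rewrite -lee_fin.
by apply: le_trans (le_U n); rewrite leeDr.
Qed.

Lemma lam_eventually_ge i : exists2 k, 0 < k & \forall n \near \oo, k <= lam n i.
Proof.
have [_ _ /(_ i) hI _ _] := hpar.
have [iI|iI] := boolP (i \in I).
  by exists 1 => //; have [/cvgryPge] := hI iI.
exists (limit_weight i / 2); first by rewrite divr_gt0// limit_weight_gt0.
apply: cvgr_ge (lam_cvg iI) _ _.
by rewrite ltr_pdivrMr// ltr_pMr ?limit_weight_gt0// ltr1n.
Qed.

Lemma limit_residual_bounded i : exists B : R, \forall n \near \oo,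
  `|T i (u n) - fd i| <= B.
Proof.
have [C C0 leC] := discrepancy_bounded i.
have [k k0 gek] := lam_eventually_ge i.
have pi0 : 0 < p i by exact: exponent_gt0.
exists ((C / k) `^ (p i)^-1 + 1); near=> n.
rewrite (_ : T i (u n) - fd i = (T i (u n) - f n i) - (fd i - f n i)); last first.
  by rewrite opprB addrA subrK.
apply: le_trans (ler_normB _ _) _; apply: lerD; last first.
  near: n; have [_ hf _ _ _] := hpar; exact: cvgr_le (hf i) _ ltr01.
rewrite -(powR_invK pi0 (normr_ge0 (T i (u n) - f n i))).
apply: ge0_ler_powR; rewrite ?invr_ge0 ?nnegrE ?powR_ge0 ?divr_ge0//;
  rewrite ?(ltW k0) ?(ltW pi0)//.
rewrite ler_pdivlMr// mulrC.
apply: (@le_trans _ _ (lam n i * `|T i (u n) - f n i| `^ p i)).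
  by rewrite ler_wpM2r// ?powR_ge0//; near: n.
by near: n.
Unshelve. all: by end_near. Qed.

(** The compactness assumption concerns one functional with fixed weights and
    data, whereas u n minimizes the n-th one.  Bounded residuals transfer the
    bound to the functional with weights 1 and data fd. *)
Lemma minimizers_compact : exists (phi : nat -> nat) (x : X),
  strictly_increasing phi /\ cvg_in tauX (u \o phi) x.
Proof.
have /choice[B BP] i := limit_residual_bounded i.
pose C := bound + 1 + \sum_(i < N) B i `^ p i.
have [M _ MP] : \forall n \near \oo,
    (J Reg p T (fun=> 1%:E) (u n) fd < (C + 1)%:E)%E.
  have BP' : \forall n \near \oo, forall i, `|T i (u n) - fd i| <= B i.
    exact: filter_forall BP.
  near=> n; have Bn : forall i, `|T i (u n) - fd i| <= B i by near: n.
  rewrite J_EFin; apply: (@le_lt_trans _ _ C%:E); last first.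
    by rewrite lte_fin ltrDl.
  rewrite /C EFinD; apply: leeD.
    apply: (@le_trans _ _ (U n)%:E); last by rewrite lee_fin; near: n.
    by apply: le_trans (le_U n); rewrite leeDl// lee_fin penalty_ge0.
  rewrite lee_fin; apply: ler_sum => i _; rewrite mul1r.
  apply: ge0_ler_powR => //; rewrite ?nnegrE//.
  - by rewrite ltW// exponent_gt0.
  - exact: le_trans (Bn i).
(* The bound holds from rank M on only, so the sequence is shifted by M. *)
have [_ _ _ comp] := hN.
have [phi [x [phiS vx]]] := comp (fun=> 1) fd (fun n => u (M + n)) (C + 1)
  (fun=> ltr01) (fun n => (hu (M + n)).1) (fun n => MP _ (leq_addr n M)).
exists (fun n => M + phi n)%N, x; split => // a b ab.
by rewrite ltn_add2l; exact: phiS.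
Unshelve. all: by end_near. Qed.

End Feasible.

Section Limit.
Context (w : X) (Rw : domR Reg w) (Cw : constrained DT T I fd w)
  (ud : X) (uud : cvg_in tauX u ud).

Let Du n : domT DT (u n). Proof. exact: (hu n).1. Qed.

(** The p_i-th power of the i-th residual is at most C / lam_i^n, which tends to
    0 for i in I; the i-th residual of ud is at most the lower limit of these
    residuals. *)
Lemma limit_constrained : constrained DT T I fd ud.
Proof.
split => [|i iI]; first exact (domT_limit hN (@Du) uud).
have [lam0 hf /(_ i iI)[lamoo _] _ _] := hpar.
have [C C0 leC] := discrepancy_bounded Rw Cw i.
apply/eqP; rewrite -subr_eq0 -normr_eq0.
suff : `|T i ud - fd i| `^ p i <= 0.
  rewrite le_eqVlt ltNge powR_ge0 orbF.
  by rewrite powR_eq0 => /andP[].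
have res := residual_powR_liminf_ge p_ge1 hN (@Du) uud hf (i := i).
apply: (liminf_ge_le res (b := fun n => C / lam n i)).
  apply: filterS leC => n; by rewrite ler_pdivlMr// mulrC.
rewrite -(mulr0 C); apply: cvgM; first exact: cvg_cst.
by apply/gtr0_cvgV0 => //; exact: nearW.
Qed.

Lemma limit_J_le (v : X) : domR Reg v -> constrained DT T I fd v ->
  (J Reg p T lamd ud fd <= J Reg p T lamd v fd)%E.
Proof.
move=> Rv Cv; rewrite !J_constrained//; last exact: limit_constrained.
have Rv_fin : Reg v \is a fin_num by rewrite ge0_fin_numE.
have [_ hf _ _ _] := hpar.
rewrite -[Reg v]fineK// -EFinD.
have U_cvg : fine (Reg v) + penalty p T (lam n) v (f n) @[n --> \oo] -->
    fine (Reg v) + penalty p T limit_weight v fd.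
  by apply: cvgD; [exact: cvg_cst | exact: penalty_cvg].
apply: (J_liminf Reg_ge0 p_ge1 hN (@Du) uud hf lam_ge0 limit_weight_ge0
  (@lam_liminf_ge) U_cvg).
apply: nearW => n /=; rewrite EFinD fineK//; apply: minimizer_le.
by have [] := Cv.
Qed.

Lemma limit_minimizer : is_minimizer (constrained DT T I fd)
  (fun v => J Reg p T lamd v fd) ud.
Proof.
split => [|v Cv]; first exact: limit_constrained.
have [Rv|] := boolP (Reg v < +oo)%E; first exact: limit_J_le.
rewrite -leNgt leye_eq => /eqP Rv.
by rewrite (J_constrained Cv) Rv leey.
Qed.

(** The limit ud is feasible, hence a competitor for every u n; with w = ud the
    upper bound for the n-th functional tends to the value at ud, so that the
    equality case [J_attained_cvg] applies. *)
Lemma limit_terms_cvg : Reg (u n) @[n --> \oo] --> Reg ud /\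
  forall i, lam n i * `|T i (u n) - f n i| `^ p i @[n --> \oo] -->
            limit_weight i * `|T i ud - fd i| `^ p i.
Proof.
have Cud := limit_constrained.
have Rud : domR Reg ud.
  apply: (@le_lt_trans _ _ (J Reg p T lamd ud fd)).
    rewrite J_constrained// leeDl// lee_fin penalty_ge0//.
    exact: limit_weight_ge0.
  apply: le_lt_trans (limit_J_le Rw Cw) _.
  by rewrite J_constrained// lte_add_pinfty ?ltry.
have Rud_fin : Reg ud \is a fin_num by rewrite ge0_fin_numE.
have [_ hf _ _ _] := hpar.
have U_cvg : fine (Reg ud) + penalty p T (lam n) ud (f n) @[n --> \oo] -->
    fine (Reg ud) + penalty p T limit_weight ud fd.
  by apply: cvgD; [exact: cvg_cst | exact: penalty_cvg].
apply: (J_attained_cvg Reg_ge0 p_ge1 hN (@Du) uud hf lam_ge0 limit_weight_ge0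
  (@lam_liminf_ge) U_cvg).
  apply: nearW => n /=; rewrite EFinD fineK//; apply: minimizer_le.
  by have [] := Cud.
by rewrite EFinD fineK.
Qed.

(** The weighted residual is the p_i-th root of the i-th term of the functional,
    which tends to 0. *)
Lemma residual_littleo i : i \in I ->
  `|T i (u n) - f n i| / (lam n i `^ (- (p i)^-1)) @[n --> \oo] --> (0 : R).
Proof.
move=> iI; have [lam0 _ _ _ _] := hpar.
have pi0 : 0 < p i by exact: exponent_gt0.
have := limit_terms_cvg.2 i; rewrite /limit_weight iI mul0r => h.
have pinv0 : 0 < (p i)^-1 by rewrite invr_gt0.
have term_ge0 n : 0 <= lam n i * `|T i (u n) - f n i| `^ p i.
  by rewrite mulr_ge0// powR_ge0.
have := cvg_powR pinv0 term_ge0 h; rewrite powR0 ?gt_eqF//.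
under eq_fun do rewrite powRM ?powR_ge0// powR_invK// mulrC.
by under [in X in _ -> X]eq_fun do rewrite powRN invrK.
Qed.

Lemma residual_cvg i : i \notin I ->
  `|T i (u n) - f n i| @[n --> \oo] --> `|T i ud - fd i|.
Proof.
move=> iI; have [lam0 _ _ _ _] := hpar.
have pi0 : 0 < p i by exact: exponent_gt0.
have pinv0 : 0 < (p i)^-1 by rewrite invr_gt0.
have m0 : limit_weight i != 0 by rewrite gt_eqF// limit_weight_gt0.
have h : `|T i (u n) - f n i| `^ p i @[n --> \oo] --> `|T i ud - fd i| `^ p i.
  rewrite -(mulfK m0 (_ `^ _)) [_ * limit_weight i]mulrC.
  have -> : (fun n => `|T i (u n) - f n i| `^ p i) =
      (fun n => lam n i * `|T i (u n) - f n i| `^ p i * (lam n i)^-1).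
    by apply/funext => n; rewrite mulrAC mulfV ?gt_eqF// mul1r.
  by apply: cvgM (limit_terms_cvg.2 i) _; exact: cvgV m0 (lam_cvg iI).
have := cvg_powR pinv0 (fun=> powR_ge0 _ _) h; rewrite powR_invK//.
by under eq_fun do rewrite powR_invK//.
Qed.

End Limit.
End Minimizers.
End Convergence.

(** * The convergence theorem *)

Theorem theorem3p2 (R : realType) (X : completeNormedModType R) (N : nat)
    (Y : 'I_N -> normedModType R)
    (Reg : X -> \bar R) (p : 'I_N -> R) (DT : 'I_N -> set X)
    (T : forall i, X -> Y i)
    (tauX : Topological X) (tauY : forall i, Topological (Y i))
    (Reg_ge0 : forall u, (0 <= Reg u)%E)
    (p_ge1 : forall i, 1 <= p i)
    (hausX : hausdorff_space (Topological.Pack tauX))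
    (hausY : forall i, hausdorff_space (Topological.Pack (tauY i)))
    (hN : assumptionN Reg p DT T tauX tauY)
    (f : nat -> forall i, Y i) (fd : forall i, Y i)
    (hf : forall i, `|fd i - f n i| @[n --> \oo] --> (0 : R))
    (I : {set 'I_N})
    (lam : nat -> 'I_N -> R) (lamd : 'I_N -> \bar R)
    (lam_gt0 : forall n i, 0 < lam n i)
    (hI : forall i, i \in I ->
       lam n i @[n --> \oo] --> +oo /\
       lam n i * `|fd i - f n i| `^ p i @[n --> \oo] --> (0 : R))
    (hIc : forall i, i \notin I -> (0 < lamd i < +oo)%E)
    (hlamd : forall i, (lam n i)%:E @[n --> \oo] --> lamd i)
    (hdom : domR Reg `&` domT DT !=set0) :
  (exists u : nat -> X, forall n,
     is_minimizer (domT DT)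
       (fun v => J Reg p T (fun i => (lam n i)%:E) v (f n)) (u n)) /\
  (limit_feasible Reg DT T I fd ->
   forall u : nat -> X,
     (forall n, is_minimizer (domT DT)
        (fun v => J Reg p T (fun i => (lam n i)%:E) v (f n)) (u n)) ->
     (exists (phi : nat -> nat) (ud : X),
        [/\ strictly_increasing phi,
            cvg_in tauX (u \o phi) ud,
            forall i, i \in I ->
              `|T i (u (phi n)) - f (phi n) i|
                / (lam (phi n) i `^ (- (p i)^-1))
              @[n --> \oo] --> (0 : R),
            forall i, i \notin I ->
              `|T i (u (phi n)) - f (phi n) i| @[n --> \oo]
                --> `|T i ud - fd i|
          & Reg (u (phi n)) @[n --> \oo] --> Reg ud]) /\
     (forall (phi : nat -> nat) (ud : X),
        strictly_increasing phi ->
        cvg_in tauX (u \o phi) ud ->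
        is_minimizer (constrained DT T I fd)
          (fun v => J Reg p T lamd v fd) ud)).
Proof.
have hpar : parameter_choice p I fd lamd f lam by split.
split.
  have /choice[u uP] n := exists_minimizer Reg_ge0 p_ge1 hN (f n) hdom (lam_gt0 n).
  by exists u.
move=> [w [Rw Cw]] u hu.
have hphi phi : strictly_increasing phi ->
    parameter_choice p I fd lamd (fun n => f (phi n)) (fun n => lam (phi n)).
  by move=> phiS; exact: parameter_choice_subseq.
have huphi (phi : nat -> nat) n := hu (phi n).
split=> [|phi ud phiS uud]; last first.
  exact: (limit_minimizer Reg_ge0 p_ge1 hN (hphi _ phiS) (@huphi phi) Rw Cw uud).
have [phi [ud [phiS uud]]] := minimizers_compact Reg_ge0 p_ge1 hN hpar hu Rw Cw.
have residualI := residual_littleo Reg_ge0 p_ge1 hN (hphi _ phiS) (@huphi phi)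
  Rw Cw uud.
have residualIc := residual_cvg Reg_ge0 p_ge1 hN (hphi _ phiS) (@huphi phi)
  Rw Cw uud.
have [RegC _] := limit_terms_cvg Reg_ge0 p_ge1 hN (hphi _ phiS) (@huphi phi)
  Rw Cw uud.
by exists phi, ud; split.
Qed.
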